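(* Let $p,q\in A=\mathbb{R}[x_1,\ldots,x_n]$, and let $S_1=S(q)$ and $S_2=S(p)$ be the corresponding semi-algebraic sets in $\mathbb{R}^n$. Suppose the following conditions are satisfied: (a) $L_{\mathrm{lex}}(p)\notin L_{\mathrm{lex}}(q)A$. (b) For every $z\in\mathbb{N}^n_1$ there exist a rational tentacle $T\in\mathcal{T}(S_1)$ of degree $z$ and an element $\pi\in G$ such that $\pi(T)\notin\mathcal{T}(S_2)$ and, furthermore, all unbounded $T'\in\mathcal{T}(S_1)$ with $\pi(T')\subseteq\pi(T)$ satisfy $\pi(T')\notin\mathcal{T}(S_2)$. Then there is no non-negative polynomial $t\in A$ such that $p(y)-t(y)q(y)\geq 0$ for all $y\in\mathbb{R}^n$.
   Context: Let $n\geq 1$ and $A=\mathbb{R}[x_1,\ldots,x_n]$. For $h\in A$, $S(h)=\{x\in\mathbb{R}^n:h(x)\geq 0\}$; $h$ is non-negative if $h(x)\ge 0$ for all $x\in\mathbb{R}^n$. $L_{\mathrm{lex}}(h)$ denotes the leading term (coefficient times monomial) of $h$ with respect to the lexicographical ordering with $x_1\succ x_2\succ\cdots\succ x_n$, and $L_{\mathrm{lex}}(q)A$ is the ideal generated by $L_{\mathrm{lex}}(q)$. Rational tentacles: for a tuple $\varphi=(\varphi_1,\ldots,\varphi_n)\in\mathbb{R}(\lambda)^n$ of non-zero rational functions in one variable $\lambda$ and a compact set $K\subseteq\mathbb{R}^n$ with non-empty interior, the rational tentacle $T_{K,\varphi}$ is $$T_{K,\varphi}=\{(\varphi_1(\lambda)x_1,\ldots,\varphi_n(\lambda)x_n):\lambda\geq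 1,\ \varphi_1(\lambda),\ldots,\varphi_n(\lambda)\text{ are defined},\ x\in K\}.$$ For a semi-algebraic set $S\subseteq\mathbb{R}^n$, $\mathcal{T}(S)$ is the set of all rational tentacles contained in $S$. The degree of a rational function is numerator degree minus denominator degree. A rational tentacle $T$ is of degree $z\in\mathbb{Z}^n$ if there exist a compact set $K\subseteq\mathbb{R}^n$ with non-empty interior and a tuple $\varphi=(\varphi_1,\ldots,\varphi_n)\in\mathbb{R}(\lambda)^n$ of non-zero rational functions with $T=T_{K,\varphi}$ and $(\deg\varphi_1,\ldots,\deg\varphi_n)=z$ (a rational tentacle may have several degrees). For $I\subseteq\{1,\ldots,n\}$ let $\pi_I:\mathbb{R}^n\to\mathbb{R}^n$ be the map with $\pi_I(x)_j=x_j$ for $j\notin I$ and $\pi_I(x)_j=-x_j$ for $j\in I$. $G$ is the group of all such maps $\pi_I$. $\mathbb{N}=\{1,2,3,\ldots\}$ and $\mathbb{N}^n_1=\{z\in\mathbb{N}^n: z_1\geq z_i\text{ for all } i\in\{1,\ldots,n\}\}$. *)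

(* Defs.v *)
(* [mpoly n R] is the polynomial ring in n variables; its library notations
   clash with those of the analysis library and are not imported. *)
From HB Require Import structures.
From mathcomp Require Import all_boot all_order all_algebra generic_quotient.
From mathcomp Require Import boolp classical_sets reals topology normedtype.
From mathcomp Require Import -(notations) mpoly.

Set Implicit Arguments.
Unset Strict Implicit.
Unset Printing Implicit Defensive.

Import Order.TTheory GRing.Theory Num.Theory.
Import numFieldNormedType.Exports.

Local Open Scope classical_set_scope.
Local Open Scope ring_scope.

Section Polynomials.
Context {R : realType} {n : nat}.
Implicit Types (f g : mpoly n R) (x : 'rV[R]_n).

Definition peval f x : R := meval (fun i => x 0 i) f.

(* S(f) *)
Definition nonneg_set f : set 'rV[R]_n := [set x | 0 <= peval f x].

Definition nonneg_poly f : Prop := forall x, 0 <= peval f x.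

(* The library orders [multinom n] by total degree first; the purely
   lexicographic order with x_1 > ... > x_n is that of the exponent tuples. *)
Definition lex_le (m1 m2 : multinom n) : bool :=
  ((m1 : n.-tuplelexi nat) <= (m2 : n.-tuplelexi nat))%O.

Definition lex_max (m1 m2 : multinom n) : multinom n :=
  if lex_le m1 m2 then m2 else m1.

(* [mnm0] is the least monomial, hence a neutral default. *)
Definition lex_lead_mnm f : multinom n :=
  \big[lex_max / mnm0]_(m <- msupp f) m.

(* L_lex(f); it is 0 for f = 0. *)
Definition lex_lead_term f : mpoly n R :=
  mcoeff (lex_lead_mnm f) f *: mpolyX R (lex_lead_mnm f).

Definition principal_ideal f : set (mpoly n R) := [set a * f | a in setT].

End Polynomials.

Section LexOrderFacts.
Context {R : realType} {n : nat}.

Lemma lex_ltP (m1 m2 : multinom n) :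
  reflect (exists2 i : 'I_n, (forall j : 'I_n, (j < i)%N -> m1 j = m2 j)
                             & (m1 i < m2 i)%N)
          (~~ lex_le m2 m1).
Proof.
rewrite /lex_le -ltNge.
by apply: (iffP (Order.TupleLexiOrder.ltxi_tuplePlt _ _)) => -[k eqk ltk]; exists k.
Qed.

Lemma lex_lead_mnm_max (f : mpoly n R) (m : multinom n) :
  m \in msupp f -> lex_le m (lex_lead_mnm f).
Proof.
rewrite /lex_lead_mnm; elim: (msupp f) => // a s IHs.
rewrite big_cons inE /lex_max /lex_le => /predU1P[->|/IHs ms].
  by case: ifP.
case: ifP => // /negbT; rewrite -ltNge => /ltW; exact: le_trans.
Qed.

Lemma lex_lead_mnm_supp (f : mpoly n R) :
  f != 0 -> lex_lead_mnm f \in msupp f.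
Proof.
rewrite -msupp_eq0 /lex_lead_mnm; elim: (msupp f) => // a [|b s] IHs _.
  rewrite big_seq1_id inE /lex_max; case: ifP => // /idP.
  rewrite /lex_le => le_a0; apply/eqP/val_inj.
  apply: (@le_anti _ (n.-tuplelexi nat)); rewrite le_a0 /=.
  rewrite andbT leNgt; apply/negP => /Order.TupleLexiOrder.ltxi_tuplePlt[k _].
  by rewrite tnth_mktuple.
rewrite big_cons {1}/lex_max; case: ifP => _; last exact: mem_head.
by rewrite in_cons IHs ?orbT.
Qed.

End LexOrderFacts.

Section RationalFunctions.

Lemma fracE (D : idomainType) (phi : {fraction D}) :
  phi = FracField.tofrac \n_(repr phi) / FracField.tofrac \d_(repr phi).
Proof.
have d0 : FracField.tofrac \d_(repr phi) != 0.
  by rewrite tofrac_eq0 denom_ratioP.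
apply: (canRL (mulfK d0)).
rewrite -[X in X * _]reprK; move: (repr phi) => x.
rewrite -[LHS]/(FracField.mul (\pi_(FracField.type D) x)%qT _) !piE.
apply/eqmodP; rewrite /= FracField.equivfE /FracField.mulf.
rewrite !numden_Ratio ?mulf_neq0 ?oner_eq0 ?denom_ratioP //.
by rewrite !mulr1 mulrC.
Qed.

Context {R : realType}.
Implicit Types phi : {fraction {poly R}}.

(* Numerator and denominator of [phi] in lowest terms (up to a common
   non-zero constant). *)
Definition rf_num phi : {poly R} :=
  let r := repr phi in \n_r %/ gcdp \n_r \d_r.
Definition rf_den phi : {poly R} :=
  let r := repr phi in \d_r %/ gcdp \n_r \d_r.

Lemma rf_den_neq0 phi : rf_den phi != 0.
Proof.
rewrite /rf_den divpN0 ?denom_ratioP // ?gcdp_eq0 ?negb_and ?denom_ratioP ?orbT //.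
by apply: leq_gcdpr; exact: denom_ratioP.
Qed.

Lemma rf_coprime phi : coprimep (rf_num phi) (rf_den phi).
Proof. by apply: coprimep_div_gcd; rewrite denom_ratioP orbT. Qed.

Lemma rf_numden phi :
  phi = FracField.tofrac (rf_num phi) / FracField.tofrac (rf_den phi).
Proof.
set g := gcdp \n_(repr phi) \d_(repr phi).
have n_def : \n_(repr phi) = rf_num phi * g by rewrite divpK ?dvdp_gcdl.
have d_def : \d_(repr phi) = rf_den phi * g by rewrite divpK ?dvdp_gcdr.
have g0 : g != 0 by rewrite gcdp_eq0 negb_and denom_ratioP orbT.
clearbody g; rewrite [LHS]fracE n_def d_def !tofracM -mulf_div.
by rewrite divff ?mulr1 // tofrac_eq0.
Qed.

Definition rf_defined phi (lam : R) : Prop := (rf_den phi).[lam] != 0.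

Definition rf_eval phi (lam : R) : R := (rf_num phi).[lam] / (rf_den phi).[lam].

(* Meaningful for [phi != 0]. *)
Definition rf_deg phi : int := (size (rf_num phi))%:Z - (size (rf_den phi))%:Z.

End RationalFunctions.

Section Tentacles.
Context {R : realType} {n : nat}.
Implicit Types (K S T : set 'rV[R]_n) (phi : 'I_n -> {fraction {poly R}}).

(* T_{K,phi} *)
Definition tentacle K phi : set 'rV[R]_n :=
  [set y | exists lam x, [/\ 1 <= lam, forall i, rf_defined (phi i) lam, K x
    & y = \row_i (rf_eval (phi i) lam * x 0 i)]].

Definition tentacle_data K phi : Prop :=
  [/\ compact K, K° !=set0 & forall i, phi i != 0].

Definition rational_tentacle T : Prop :=
  exists K phi, tentacle_data K phi /\ T = tentacle K phi.

Definition of_degree T (z : 'I_n -> int) : Prop :=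
  exists K phi, [/\ tentacle_data K phi, T = tentacle K phi
    & forall i, rf_deg (phi i) = z i].

(* The calligraphic T(S). *)
Definition tentacles_in S : set (set 'rV[R]_n) :=
  [set T | rational_tentacle T /\ T `<=` S].

Definition flip (I : {set 'I_n}) (x : 'rV[R]_n) : 'rV[R]_n :=
  \row_j (if j \in I then - x 0 j else x 0 j).

(* The underlying set of the group G. *)
Definition flips : set ('rV[R]_n -> 'rV[R]_n) := range flip.

End Tentacles.

(* N^n_1, where N starts at 1 and the dimension is n.+1. *)
Definition Nn1 {n : nat} : set ('I_n.+1 -> int) :=
  [set z | (forall i, 1 <= z i) /\ (forall i, z i <= z ord0)].

(* Main.v *)
Require Import Defs.
From mathcomp Require Import all_boot all_order all_algebra.
From mathcomp Require Import boolp classical_sets reals topology normedtype.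
From mathcomp Require Import -(notations) mpoly.
From mathcomp Require Import lra.
Import Order.TTheory GRing.Theory Num.Theory.
Import numFieldNormedType.Exports.
Local Open Scope classical_set_scope.
Local Open Scope ring_scope.

(** Suppose [t >= 0] and [p >= t q] everywhere. The degree [z] is chosen so
    steep, [z_1 >> z_2 >> ... >> z_n], that along a curve [lam |-> (phi_i(lam)
    x_i)_i] with [deg phi = z] and all [x_i] non-zero the size of a polynomial
    is governed by its lexicographically leading monomial: if the monomial has
    exponent vector [m], then the value is of exact order [lam ^ <z, m>]
    ([growth_peval]). Exact orders multiply, so [t q], if non-zero, has the
    order of the monomial [lead t + lead q], which differs from [lead p]
    because [L_lex(p)] is not a multiple of [L_lex(q)]. A steep [z] also
    separates distinct monomials, so along every such curve, reflected or not,
    one of [|p|] and [|t q|] eventually exceeds the other, and which one it is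
    depends on the polynomials only ([domination_dichotomy]).

    Let [T], contained in [S(q)], be the tentacle of degree [z] given by the
    hypothesis, and [pi] the reflection that comes with it. Shrink the compact
    base of [T] so that it avoids the coordinate hyperplanes
    ([subcompact_off_hyperplanes]).

    If [t q] dominates, a point of [T] over the smaller base and far out
    suffices: there [q >= 0], hence [p >= t q >= 0], and [|p| < |t q|] is
    impossible.

    If [p] dominates, keep only large values of the parameter over the smaller
    base. After the substitution of [lam + L] for [lam] this is again a
    rational tentacle [T'], it is unbounded, and [pi(T')] is not contained in
    [S(p)]. So [p < 0] at some point of [pi(T')], where [t q <= p < 0]
    contradicts [|t q| < |p|].

    All estimates are uniform in the base point [x]; the predicate [growth]
    packages this uniformity, and serves both for univariate polynomials in
    the parameter, hence for the components [phi_i], and for polynomials in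
    several variables along the curve. *)

Set Implicit Arguments.
Unset Strict Implicit.
Unset Printing Implicit Defensive.

(** * Uniform orders of growth *)

Section Growth.
Context {R : realType} {T : Type} (K : set T).
Implicit Types (F G : R -> T -> R) (d e : nat).

(** [|F lam x|] is of exact order [lam ^ d] as [lam] tends to infinity,
    uniformly in [x] in [K]. *)
Definition growth F d : Prop :=
  exists c C : R, [/\ 0 < c, 0 < C &
    \forall lam \near +oo, forall x, K x ->
      c * lam ^+ d <= `|F lam x| <= C * lam ^+ d].

Definition negligible F d : Prop :=
  forall eps : R, 0 < eps ->
    \forall lam \near +oo, forall x, K x -> `|F lam x| <= eps * lam ^+ d.

Lemma growth_eq_norm F G d :
  (\forall lam \near +oo, forall x, K x -> `|F lam x| = `|G lam x|) ->
  growth F d -> growth G d.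
Proof.
move=> eqFG [c [C [c0 C0 Fd]]]; exists c, C; split=> //.
by near=> lam => x Kx; rewrite -(near eqFG lam) //; apply: (near Fd lam).
Unshelve. all: by end_near.
Qed.

Lemma growth_const (f : T -> R) (c C : R) :
  0 < c -> (forall x, K x -> c <= `|f x| <= C) -> growth (fun _ => f) 0.
Proof.
move=> c0 fK; exists c, (Num.max C 1); split=> //.
  by rewrite lt_max ltr01 orbT.
apply: nearW => lam x /fK /andP[cf fC]; rewrite !expr0 !mulr1 cf /=.
by rewrite le_max fC.
Qed.

Lemma growth1 : growth (fun _ _ => 1) 0.
Proof.
by apply: (@growth_const (fun=> 1) 1 1) => // x _; rewrite normr1 lexx.
Qed.

Lemma growth_id : growth (fun lam _ => lam) 1.
Proof.
exists 1, 1; split=> //; near=> lam => x _.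
have lam0 : 0 <= lam by near: lam; apply: nbhs_pinfty_ge.
by rewrite expr1 mul1r ger0_norm ?lexx.
Unshelve. all: by end_near.
Qed.

Lemma growthM F G d e : growth F d -> growth G e ->
  growth (fun lam x => F lam x * G lam x) (d + e).
Proof.
move=> [c [C [c0 C0 Fd]]] [b [B [b0 B0 Ge]]].
exists (c * b), (C * B); split; rewrite ?mulr_gt0 //.
near=> lam => x Kx.
have lam0 : 0 <= lam by near: lam; apply: nbhs_pinfty_ge.
have /(_ _ x Kx)/andP[//|F1 F2] := near Fd lam.
have /(_ _ x Kx)/andP[//|G1 G2] := near Ge lam.
by rewrite normrM exprD !(mulrACA _ _ (_ ^+ d)) !ler_pM ?mulr_ge0 ?exprn_ge0 // ltW.
Unshelve. all: by end_near.
Qed.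

Lemma growthX F d k : growth F d -> growth (fun lam x => F lam x ^+ k) (d * k).
Proof.
move=> Fd; elim: k => [|k IHk].
  rewrite muln0; apply: growth_eq_norm growth1.
  by apply: nearW => lam x _; rewrite expr0.
rewrite mulnS; have := growthM Fd IHk; apply: growth_eq_norm.
by apply: nearW => lam x _; rewrite exprS.
Qed.

Lemma growth_prod (I : Type) (s : seq I) (F : I -> R -> T -> R) (d : I -> nat) :
  (forall i, growth (F i) (d i)) ->
  growth (fun lam x => \prod_(i <- s) F i lam x) (\sum_(i <- s) d i).
Proof.
move=> Fd; elim: s => [|i s IHs].
  rewrite big_nil; apply: growth_eq_norm growth1.
  by apply: nearW => lam x _; rewrite big_nil.
rewrite big_cons; have := growthM (Fd i) IHs; apply: growth_eq_norm.
by apply: nearW => lam x _; rewrite big_cons.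
Qed.

Lemma growth_div F G d e : growth F (d + e) -> growth G e ->
  growth (fun lam x => F lam x / G lam x) d.
Proof.
move=> [c [C [c0 C0 Fd]]] [b [B [b0 B0 Ge]]].
exists (c / B), (C / b); split; rewrite ?divr_gt0 //.
near=> lam => x Kx.
have lam0 : 0 < lam by near: lam; apply: nbhs_pinfty_gt.
have /(_ _ x Kx)/andP[//|F1 F2] := near Fd lam.
have /(_ _ x Kx)/andP[//|G1 G2] := near Ge lam.
have lame0 : 0 < lam ^+ e by rewrite exprn_gt0.
have G0 : 0 < `|G lam x| by apply: lt_le_trans G1; rewrite mulr_gt0.
rewrite normrM normfV ler_pdivlMr // ler_pdivrMr //; apply/andP; split.
  apply: le_trans F1.
  have -> : c * lam ^+ (d + e) = c / B * lam ^+ d * (B * lam ^+ e).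
    by rewrite exprD mulrACA divfK ?gt_eqF.
  by rewrite ler_wpM2l // mulr_ge0 ?divr_ge0 ?exprn_ge0 // ltW.
apply: (le_trans F2).
have -> : C * lam ^+ (d + e) = C / b * lam ^+ d * (b * lam ^+ e).
  by rewrite exprD mulrACA divfK ?gt_eqF.
by rewrite ler_wpM2l // mulr_ge0 ?divr_ge0 ?exprn_ge0 // ltW.
Unshelve. all: by end_near.
Qed.

Lemma negligible_growth F d e (a : R) : (e < d)%N -> growth F e ->
  negligible (fun lam x => a * F lam x) d.
Proof.
move=> ed [c [C [c0 C0 Fe]]] eps eps0; near=> lam => x Kx.
have lam1 : 1 <= lam by near: lam; apply: nbhs_pinfty_ge.
have /(_ _ x Kx)/andP[//|_ F2] := near Fe lam.
have aC : `|a| * C / eps <= lam.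
  by near: lam; apply: nbhs_pinfty_ge; rewrite num_real.
have lam0 : 0 <= lam := le_trans ler01 lam1.
rewrite normrM; apply: (le_trans (ler_wpM2l (normr_ge0 _) F2)).
rewrite mulrA; apply: (@le_trans _ _ (eps * lam * lam ^+ e)).
  by rewrite ler_wpM2r ?exprn_ge0 // -ler_pdivrMl // mulrC.
by rewrite -mulrA -exprS ler_wpM2l ?(ltW eps0) // ler_weXn2l.
Unshelve. all: by end_near.
Qed.

Lemma negligible_sum (J : eqType) (s : seq J) (P : pred J)
    (F : J -> R -> T -> R) d :
  (forall j, j \in s -> P j -> negligible (F j) d) ->
  negligible (fun lam x => \sum_(j <- s | P j) F j lam x) d.
Proof.
elim: s => [|j s IHs] Fd eps eps0.
  near=> lam => x _; rewrite big_nil normr0.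
  have lam0 : 0 <= lam by near: lam; apply: nbhs_pinfty_ge.
  by rewrite mulr_ge0 ?exprn_ge0 // ltW.
have Fs : negligible (fun lam x => \sum_(j <- s | P j) F j lam x) d.
  by apply: IHs => i si; apply: Fd; rewrite inE si orbT.
case Pj: (P j); last first.
  by have := Fs eps eps0; apply: filterS => lam H x Kx; rewrite big_cons Pj; exact: H.
have e20 : 0 < eps / 2 by rewrite divr_gt0.
have Fj := Fd j (mem_head _ _) Pj _ e20.
have {}Fs := Fs _ e20.
near=> lam => x Kx; rewrite big_cons Pj [eps]splitr mulrDl.
apply: (le_trans (ler_normD _ _)).
by apply: lerD; [exact: (near Fj lam) | exact: (near Fs lam)].
Unshelve. all: by end_near.
Qed.

Lemma growthD_negligible F G d : growth F d -> negligible G d ->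
  growth (fun lam x => F lam x + G lam x) d.
Proof.
move=> [c [C [c0 C0 Fd]]] Gd.
exists (c / 2), (C + c / 2); split; rewrite ?addr_gt0 ?divr_gt0 //.
have {}Gd := Gd (c / 2) (divr_gt0 c0 (ltr0n R 2)).
near=> lam => x Kx.
have /(_ _ x Kx)/andP[//|F1 F2] := near Fd lam.
have G2 : `|G lam x| <= c / 2 * lam ^+ d by apply: (near Gd lam).
rewrite mulrDl; apply/andP; split; last first.
  by apply: (le_trans (ler_normD _ _)); apply: lerD.
have := lerB_normD (F lam x) (G lam x).
apply: le_trans; rewrite lerBrDr.
by apply: le_trans F1; rewrite {2}[c]splitr mulrDl lerD2l.
Unshelve. all: by end_near.
Qed.

(** The common source of both leading-term estimates below: a linear
    combination has the order of its fastest term as soon as that term is the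
    only one of its order, since the finitely many others are negligible. *)
Lemma growth_dominant (J : eqType) (s : seq J) (a : J -> R)
    (F : J -> R -> T -> R) (d : J -> nat) (j0 : J) :
  uniq s -> j0 \in s -> a j0 != 0 -> (forall j, growth (F j) (d j)) ->
  (forall j, j \in s -> j != j0 -> (d j < d j0)%N) ->
  growth (fun lam x => \sum_(j <- s) a j * F j lam x) (d j0).
Proof.
move=> us sj0 a0 Fd dj0.
have lead : growth (fun lam x => a j0 * F j0 lam x) (d j0).
  rewrite -[d j0]add0n; apply: growthM (Fd j0).
  by apply: (@growth_const _ `|a j0| `|a j0|); rewrite ?normr_gt0 // => x; rewrite lexx.
have rest : negligible (fun lam x => \sum_(j <- s | j != j0) a j * F j lam x) (d j0).
  by apply: negligible_sum => j sj jj0; apply: (negligible_growth _ _ (Fd j)); exact: dj0.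
have := growthD_negligible lead rest; apply: growth_eq_norm.
by apply: nearW => lam x _; rewrite (bigD1_seq j0).
Qed.

Lemma growth_lt F G d e : growth F d -> growth G e -> (d < e)%N ->
  \forall lam \near +oo, forall x, K x -> `|F lam x| < `|G lam x|.
Proof.
move=> Fd [b [B [b0 _ Ge]]] de.
have := negligible_growth 1 de Fd.
move=> /(_ (b / 2) (divr_gt0 b0 (ltr0n R 2))) Fe.
near=> lam => x Kx.
have lam0 : 0 < lam by near: lam; apply: nbhs_pinfty_gt.
have /(_ _ x Kx)/andP[//|G1 _] := near Ge lam.
apply: lt_le_trans G1; rewrite -[F lam x]mul1r.
apply: (le_lt_trans (near Fe lam _ x Kx)) => //.
by rewrite ltr_pM2r ?exprn_gt0 // ltr_pdivrMr // ltr_pMr // ltr1n.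
Unshelve. all: by end_near.
Qed.

Lemma growth_neq0 F d : growth F d ->
  \forall lam \near +oo, forall x, K x -> F lam x != 0.
Proof.
move=> [c [C [c0 _ Fd]]]; near=> lam => x Kx.
have lam0 : 0 < lam by near: lam; apply: nbhs_pinfty_gt.
have /(_ _ x Kx)/andP[//|F1 _] := near Fd lam.
by rewrite -normr_gt0; apply: lt_le_trans F1; rewrite mulr_gt0 ?exprn_gt0.
Unshelve. all: by end_near.
Qed.

Lemma growth_horner (h : {poly R}) : h != 0 ->
  growth (fun lam _ => h.[lam]) (size h).-1.
Proof.
move=> h0.
have sh : ((size h).-1 < size h)%N by rewrite prednK // size_poly_gt0.
pose X (j : 'I_(size h)) : R -> T -> R := fun lam _ => lam ^+ j.
(* The orders are written [1 * j] to match the powers of the identity. *)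
have := @growth_dominant _ (index_enum 'I_(size h)) (fun j => h`_j) X
  (fun j => 1 * j)%N (Ordinal sh).
rewrite /= mul1n => H.
apply: growth_eq_norm (H _ _ _ _ _); rewrite ?index_enum_uniq ?mem_index_enum //.
- by apply: nearW => lam x _; rewrite horner_coef.
- by rewrite -lead_coefE lead_coef_eq0.
- by move=> j; apply: growthX growth_id.
- move=> j _; rewrite mul1n ltn_neqAle -val_eqE /= => -> /=.
  by rewrite -ltnS prednK ?size_poly_gt0.
Qed.

End Growth.

(** * Weights that refine the lexicographic order *)

Section LexWeight.
Context {n : nat}.
Implicit Types m : multinom n.+1.

Definition weight (z : 'I_n.+1 -> nat) m : nat := \sum_i z i * m i.

(** With these weights a monomial whose exponents are at most [B] is weighed
    by the number having these exponents as digits in base [B.+1], the first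
    variable giving the most significant digit. *)
Definition base_weight (B : nat) (i : 'I_n.+1) : nat := (B.+1 ^ (n - i))%N.

(** A number whose remaining digits are all maximal still falls short of the
    next unit: the geometric sum of [B * B.+1 ^ i] over [i < n - k] is
    [B.+1 ^ (n - k) - 1]. *)
Lemma base_weight_tail (B : nat) (k : 'I_n.+1) :
  (\sum_(i < n.+1 | (k < i)%N) base_weight B i * B < base_weight B k)%N.
Proof.
rewrite (reindex_inj rev_ord_inj) /= /base_weight.
have -> : (\sum_(i < n.+1 | (k < n.+1 - i.+1)%N) B.+1 ^ (n - (n.+1 - i.+1)) * B)%N
   = (\sum_(i < n.+1 | (i < n - k)%N) B.+1 ^ i * B)%N.
  apply: eq_big => i; rewrite subSS.
    by rewrite ltn_subRL addnC -ltn_subRL.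
  by rewrite subKn // -ltnS.
rewrite -(big_ord_widen_cond n.+1 xpredT (fun i => B.+1 ^ i * B)%N); last first.
  by rewrite leqW // leq_subr.
rewrite -big_distrl /= mulnC -[X in (X * _)%N]/(B.+1.-1) -predn_exp.
by rewrite ltn_predL expn_gt0.
Qed.

(** Comparing digit strings: at the first differing exponent [m2] gains a full
    unit, which the lower digits of [m1] cannot make up. *)
Lemma weight_lt_lex (B : nat) m1 m2 : (forall i, (m1 i <= B)%N) ->
  ~~ lex_le m2 m1 -> (weight (base_weight B) m1 < weight (base_weight B) m2)%N.
Proof.
move=> m1B /lex_ltP[k eqk ltk]; rewrite /weight.
have split3 (m : multinom n.+1) : (\sum_i base_weight B i * m i =
    \sum_(i < n.+1 | (i < k)%N) base_weight B i * m i + (base_weight B k * m k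
    + \sum_(i < n.+1 | (k < i)%N) base_weight B i * m i))%N.
  rewrite (bigID (fun i : 'I_n.+1 => (i < k)%N)) /=; congr addn.
  rewrite (bigD1 k) ?ltnn //=; congr addn; apply: eq_bigl => i.
  by rewrite -leqNgt ltn_neqAle andbC eq_sym val_eqE.
rewrite !split3 (eq_bigr (fun i : 'I_n.+1 => base_weight B i * m2 i)%N); last first.
  by move=> i /eqk ->.
rewrite ltn_add2l.
apply: (@leq_trans (base_weight B k * (m1 k).+1)); last first.
  by apply: leq_trans (leq_addr _ _); rewrite leq_mul2l ltk orbT.
rewrite mulnSr ltn_add2l; apply: leq_ltn_trans (base_weight_tail B k).
by apply: leq_sum => i _; rewrite leq_mul2l m1B orbT.
Qed.

Lemma lex_neq_lt m1 m2 : m1 != m2 -> ~~ lex_le m1 m2 || ~~ lex_le m2 m1.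
Proof.
apply: contraNT; rewrite negb_or !negbK /lex_le => le12.
exact/eqP/val_inj/(@le_anti _ (n.+1.-tuplelexi nat)).
Qed.

Lemma weight_neq (B : nat) m1 m2 :
  (forall i, (m1 i <= B)%N) -> (forall i, (m2 i <= B)%N) -> m1 != m2 ->
  (weight (base_weight B) m1 != weight (base_weight B) m2)%N.
Proof.
move=> m1B m2B /lex_neq_lt /orP[] /weight_lt_lex; rewrite neq_ltn.
  by move=> ->; rewrite ?orbT.
by move=> ->.
Qed.

Lemma weightD z m1 m2 :
  weight z (mnm_add m1 m2) = (weight z m1 + weight z m2)%N.
Proof.
by rewrite -big_split; apply: eq_bigr => i _; rewrite mnmDE mulnDr.
Qed.

Lemma mnm_lt_msize {R : realType} (f : mpoly n.+1 R) m i :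
  m \in msupp f -> (m i < msize f)%N.
Proof.
move/msize_mdeg_lt; apply: leq_ltn_trans.
by rewrite mdegE (bigD1 i) //= leq_addr.
Qed.

End LexWeight.

(** * Polynomials along steep curves *)

Section Evaluation.
Context {R : realType} {n : nat} {T : Type} (K : set T).
Variable Y : R -> T -> 'rV[R]_n.+1.

(** The leading monomial has strictly the largest weight among those of [f],
    so it is the fastest term of the expansion of [f (Y lam x)]. *)
Lemma growth_peval (B : nat) (f : mpoly n.+1 R) :
  (forall i, growth K (fun lam x => Y lam x 0 i) (base_weight B i)) ->
  f != 0 -> (msize f <= B)%N ->
  growth K (fun lam x => peval f (Y lam x))
    (weight (base_weight B) (lex_lead_mnm f)).
Proof.
move=> Yz f0 fB.
have := @growth_dominant R T K _ (msupp f) (fun m => mcoeff m f)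
  (fun m lam x => \prod_i Y lam x 0 i ^+ m i) (weight (base_weight B))
  (lex_lead_mnm f) (msupp_uniq f) (lex_lead_mnm_supp f0).
move=> H; apply: growth_eq_norm (H _ _ _).
- by apply: nearW => lam x _; rewrite /peval mevalE.
- by rewrite mcoeff_eq0 negbK lex_lead_mnm_supp.
- by move=> m; apply: growth_prod => i; apply: growthX.
move=> m mf mlead; apply: weight_lt_lex => [i|].
  by apply: leq_trans fB; apply/ltnW/mnm_lt_msize.
have := lex_neq_lt mlead.
by rewrite lex_lead_mnm_max.
Qed.

End Evaluation.

(** Over a field, a term is a multiple of a non-zero one as soon as its
    monomial is, so the non-divisibility hypothesis speaks of monomials only. *)
Lemma lex_lead_neq (R : realType) (n : nat) (p q t : mpoly n.+1 R) :
  ~ principal_ideal (lex_lead_term q) (lex_lead_term p) -> q != 0 ->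
  lex_lead_mnm p != mnm_add (lex_lead_mnm t) (lex_lead_mnm q).
Proof.
move=> pNq q0; apply/eqP => pE; apply: pNq.
have cq : mcoeff (lex_lead_mnm q) q != 0 by rewrite mcoeff_eq0 negbK lex_lead_mnm_supp.
exists (mcoeff (lex_lead_mnm p) p / mcoeff (lex_lead_mnm q) q
        *: mpolyX R (lex_lead_mnm t)) => //.
rewrite /lex_lead_term -scalerAl -scalerAr scalerA divfK // -mpolyXD.
by rewrite -pE.
Qed.

(** The alternative is decided by the weights of [lead p] and
    [lead t + lead q], which explains why it is uniform in the curve; this is
    needed to apply it to a curve and to its reflections.  The order of [t q]
    is the sum of the orders of [t] and [q].  When [t q = 0], [p] dominates because it
    grows at a definite rate and is thus eventually non-zero. *)
Lemma domination_dichotomy (R : realType) (n B : nat) (p q t : mpoly n.+1 R) :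
  ~ principal_ideal (lex_lead_term q) (lex_lead_term p) ->
  (msize p <= B)%N -> (msize q + msize t <= B)%N ->
  let dominates T (K : set T) (Y : R -> T -> 'rV[R]_n.+1)
      (f g : mpoly n.+1 R) :=
    (forall i, growth K (fun lam x => Y lam x 0 i) (base_weight B i)) ->
    \forall lam \near +oo, forall x, K x ->
      `|peval g (Y lam x)| < `|peval f (Y lam x)| in
  (forall T K Y, @dominates T K Y p (t * q)) \/
  (forall T K Y, @dominates T K Y (t * q) p).
Proof.
move=> pNq pB tqB dominates.
have p0 : p != 0.
  apply/eqP => p0; apply: pNq; exists 0 => //.
  by rewrite mul0r /lex_lead_term p0 mcoeff0 scale0r.
have [tq0|tq0] := eqVneq (t * q) 0.
  left=> T K Y Yz; rewrite tq0.
  have /growth_neq0 := growth_peval Yz p0 pB.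
  apply: filterS => lam H x Kx.
  by rewrite /peval meval0 normr0 normr_gt0; apply: H.
have [t0 q0] : t != 0 /\ q != 0 by apply/andP; rewrite -negb_or -mulf_eq0.
have growth_tq T (K : set T) (Y : R -> T -> 'rV[R]_n.+1) :
    (forall i, growth K (fun lam x => Y lam x 0 i) (base_weight B i)) ->
    growth K (fun lam x => peval (t * q) (Y lam x))
      (weight (base_weight B) (mnm_add (lex_lead_mnm t) (lex_lead_mnm q))).
  move=> Yz; rewrite weightD.
  have tB : (msize t <= B)%N := leq_trans (leq_addl _ _) tqB.
  have qB : (msize q <= B)%N := leq_trans (leq_addr _ _) tqB.
  apply: growth_eq_norm (growthM (growth_peval Yz t0 tB) (growth_peval Yz q0 qB)).
  by apply: nearW => lam x _; rewrite /peval mevalM.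
have := lex_lead_neq t pNq q0 => /(weight_neq (B := B)).
rewrite neq_ltn => /(_ _ _)/orP[i|i|lt|lt].
- by apply: leq_trans pB; apply/ltnW/mnm_lt_msize/lex_lead_mnm_supp.
- rewrite mnmDE addnC; apply: leq_trans tqB.
  by apply: leq_add; apply/ltnW/mnm_lt_msize/lex_lead_mnm_supp.
- by right=> T K Y Yz; exact: growth_lt (growth_peval Yz p0 pB) (growth_tq _ _ _ Yz) lt.
- by left=> T K Y Yz; exact: growth_lt (growth_tq _ _ _ Yz) (growth_peval Yz p0 pB) lt.
Qed.

(** * Rational functions and tentacles *)

Section Tentacles.
Context {R : realType}.

(** Lowest terms [rf_num], [rf_den] and a given fraction [a / b] satisfy
    [rf_num * b = a * rf_den]; if [rf_den] vanished at [lam] then so would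
    [rf_num], against coprimality. *)
Lemma rf_frac_eval (a b : {poly R}) (lam : R) : b.[lam] != 0 ->
  rf_defined (tofrac a / tofrac b) lam /\
  rf_eval (tofrac a / tofrac b) lam = a.[lam] / b.[lam].
Proof.
move=> blam; set phi := (tofrac a / tofrac b).
have b0 : b != 0 by apply: contraNneq blam => ->; rewrite horner0.
have numden : rf_num phi * b = a * rf_den phi.
  apply/eqP; rewrite -tofrac_eq !tofracM -eqr_div ?tofrac_eq0 ?rf_den_neq0 //.
  by rewrite -rf_numden.
have eq_lam : (rf_num phi).[lam] * b.[lam] = a.[lam] * (rf_den phi).[lam].
  by rewrite -!hornerM numden.
have def : rf_defined phi lam.
  apply/eqP => den0; move/eqP: eq_lam.
  rewrite den0 mulr0 mulf_eq0 (negbTE blam) orbF => num0.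
  by have := coprimep_root (rf_coprime phi) num0; rewrite den0 eqxx.
by split=> //; apply/eqP; rewrite eqr_div // eq_lam.
Qed.

Lemma growth_rf_eval (T : Type) (K : set T) (phi : {fraction {poly R}})
    (d : nat) :
  phi != 0 -> rf_deg phi = d%:Z -> growth K (fun lam _ => rf_eval phi lam) d.
Proof.
move=> phi0 degphi.
have num0 : rf_num phi != 0.
  by apply: contraNneq phi0 => num0; rewrite [phi]rf_numden num0 tofrac0 mul0r.
have den0 := rf_den_neq0 phi.
apply: growth_div (growth_horner K den0).
suff <- : (size (rf_num phi)).-1 = (d + (size (rf_den phi)).-1)%N.
  exact: growth_horner.
move/eqP: degphi; rewrite /rf_deg subr_eq -PoszD => /eqP[->].
by rewrite -subn1 -addnBA ?size_poly_gt0 // subn1.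
Qed.

Lemma near_rf_defined (phi : {fraction {poly R}}) :
  \forall lam \near +oo, rf_defined phi lam.
Proof.
have := growth_neq0 (growth_horner [set: unit] (rf_den_neq0 phi)).
by apply: filterS => lam /(_ tt I).
Qed.

Context {n : nat}.
Implicit Types K : set 'rV[R]_n.

Lemma rational_tentacle_frac K (a b : 'I_n -> {poly R}) :
  compact K -> K° !=set0 -> (forall i, a i != 0) ->
  (forall i lam, 1 <= lam -> (b i).[lam] != 0) ->
  rational_tentacle [set y | exists lam x, [/\ 1 <= lam, K x &
    y = \row_i ((a i).[lam] / (b i).[lam] * x 0 i)]].
Proof.
move=> cK K0 a0 b0; exists K, (fun i => tofrac (a i) / tofrac (b i)); split.
  split=> // i; rewrite mulf_neq0 ?invr_eq0 ?tofrac_eq0 //.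
  by apply: contraTneq (b0 i 1 (lexx 1)) => ->; rewrite horner0 eqxx.
apply/seteqP; split=> y [lam [x]] => [[lam1 Kx ->] | [lam1 _ Kx ->]].
  exists lam, x; split=> // [i|]; first by case: (rf_frac_eval (a i) (b0 i _ lam1)).
  apply/rowP => i; rewrite !mxE.
  by case: (rf_frac_eval (a i) (b0 i _ lam1)) => _ ->.
exists lam, x; split=> //; apply/rowP => i; rewrite !mxE.
by case: (rf_frac_eval (a i) (b0 i _ lam1)) => _ ->.
Qed.

Lemma normr_coord_le (x : 'rV[R]_n) i : `|x 0 i| <= `|x|.
Proof.
rewrite [leRHS]mx_normrE.
exact: (le_bigmax _ (fun j : 'I_1 * 'I_n => `|x j.1 j.2|) (0, i)).
Qed.

(** Push an interior point away from the hyperplanes, moving each coordinate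
    by half the radius in the direction of its sign; a small ball around the
    new point stays in [K] and at distance at least [r / 4] from each
    coordinate hyperplane. *)
Lemma subcompact_off_hyperplanes K : compact K -> K° !=set0 ->
  exists K' : set 'rV[R]_n, [/\ compact K', K'° !=set0, K' `<=` K &
    exists c C : R, 0 < c /\
      forall x, K' x -> forall i, c <= `|x 0 i| <= C].
Proof.
move=> cK [x0 /nbhs_ballP[r /= r0 rK]].
pose a : 'rV[R]_n := \row_i (if 0 <= x0 0 i then x0 0 i + r / 2 else x0 0 i - r / 2).
have r8 : 0 < r / 8 by rewrite divr_gt0.
have near_a x : closed_ball a (r / 8) x -> forall i, `|a 0 i - x 0 i| < r / 4.
  move=> /(closed_ball_subset r8 (r1 := r / 4)) ax i.
  by case: ax; [lra | move=> _; exact].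
have r4_le x : closed_ball a (r / 8) x -> forall i,
    r / 4 <= `|x 0 i| /\ `|x0 0 i - x 0 i| < r.
  move=> /near_a ax i; move: (ax i); rewrite mxE !ltr_norml.
  case: ifPn; rewrite -?ltNge => x0i /andP[ax1 ax2].
    by split; [rewrite ger0_norm; lra | lra].
  by split; [rewrite ler0_norm; lra | lra].
have sub : closed_ball a (r / 8) `<=` K.
  move=> x /r4_le ax; apply: rK; split=> // j i; rewrite ord1.
  by have [_] := ax i.
exists (closed_ball a (r / 8)); split=> //.
- by apply: subclosed_compact sub; [exact: closed_ball_closed | ].
- by exists a; have [] := open_nbhs_closed_ball a r8.
exists (r / 4), (`|x0| + r); split=> [|x /r4_le ax i]; first by lra.
have [-> /= x0x] := ax i; have x0i := normr_coord_le x0 i.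
have := lerB_dist (x 0 i) (x0 0 i); rewrite distrC; lra.
Qed.

End Tentacles.

(** * Tails of tentacles *)

Section Tails.
Context {R : realType} {n : nat}.
Implicit Types (K : set 'rV[R]_n) (phi : 'I_n -> {fraction {poly R}}).

Definition curve phi (lam : R) (x : 'rV[R]_n) : 'rV[R]_n :=
  \row_i (rf_eval (phi i) lam * x 0 i).

(** The part of the tentacle with parameter at least [1 + L], reparametrized so
    that the parameter starts at [1] again. *)
Definition tail K phi (L : R) : set 'rV[R]_n :=
  [set y | exists lam x, [/\ 1 <= lam, K x & y = curve phi (lam + L) x]].

Lemma flip0 : flip finset.set0 = id :> ('rV[R]_n -> 'rV[R]_n).
Proof. by apply/funext => x; apply/rowP => i; rewrite mxE finset.inE. Qed.

Lemma normr_flip I (x : 'rV[R]_n) i : `|flip I x 0 i| = `|x 0 i|.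
Proof. by rewrite mxE; case: ifP; rewrite ?normrN. Qed.

Lemma growth_curve K phi (d : 'I_n -> nat) (c C : R) i :
  0 < c -> (forall x, K x -> forall i, c <= `|x 0 i| <= C) ->
  phi i != 0 -> rf_deg (phi i) = (d i)%:Z ->
  growth K (fun lam x => curve phi lam x 0 i) (d i).
Proof.
move=> c0 Kc phi0 degphi; rewrite -[d i]addn0.
have xi := @growth_const R _ K (fun x => x 0 i) c C c0 (fun x Kx => Kc x Kx i).
apply: growth_eq_norm (growthM (growth_rf_eval K phi0 degphi) xi).
by apply: nearW => lam x _; rewrite mxE.
Qed.

(** The shift of the parameter and the signs of the reflection are both
    absorbed into the rational functions: [phi_i] becomes
    [+- phi_i(lam + L)], over the same base [K]. *)
Lemma rational_tentacle_flip_tail K phi (L : R) (I : {set 'I_n}) :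
  compact K -> K° !=set0 -> (forall i, phi i != 0) ->
  (forall lam, 1 <= lam -> forall i, rf_defined (phi i) (lam + L)) ->
  rational_tentacle (flip I @` tail K phi L).
Proof.
move=> cK K0 phi0 def.
pose shift : {poly R} := 'X + L%:P.
pose b i := rf_den (phi i) \Po shift.
pose a i := (if i \in I then -1 else 1) *: (rf_num (phi i) \Po shift).
have shiftE (h : {poly R}) lam : (h \Po shift).[lam] = h.[lam + L].
  by rewrite horner_comp /shift !hornerE.
suff -> : flip I @` tail K phi L = [set y | exists lam x, [/\ 1 <= lam, K x &
    y = \row_i ((a i).[lam] / (b i).[lam] * x 0 i)]].
  apply: rational_tentacle_frac => // [i|i lam lam1]; last first.
    by rewrite shiftE; apply: def.
  rewrite scaler_eq0 comp_poly2_eq0 ?size_XaddC // negb_or; apply/andP; split.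
    by case: ifP; rewrite ?oppr_eq0 oner_eq0.
  by apply: contraNneq (phi0 i) => num0; rewrite [phi i]rf_numden num0 tofrac0 mul0r.
have flipE lam x : flip I (curve phi (lam + L) x) =
    \row_i ((a i).[lam] / (b i).[lam] * x 0 i).
  apply/rowP => i; rewrite !mxE hornerZ !shiftE /rf_eval.
  by case: ifP => _; rewrite ?mulN1r ?mul1r // !mulNr.
apply/seteqP; split=> [_ [_ [lam [x [lam1 Kx ->]]] <-] | _ [lam [x [lam1 Kx ->]]]].
  by exists lam, x; split; rewrite // flipE.
by exists (curve phi (lam + L) x); rewrite ?flipE //; exists lam, x.
Qed.

End Tails.

Lemma unbounded_tail (R : realType) (n : nat) (K : set 'rV[R]_n)
    (phi : 'I_n -> {fraction {poly R}}) (L : R) (i : 'I_n) (d : nat) :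
  K !=set0 -> (0 < d)%N -> growth K (fun lam x => curve phi lam x 0 i) d ->
  ~ bounded_set (tail K phi L).
Proof.
move=> [x Kx] d0 [c [C [c0 _ Yd]]] /pinfty_ex_gt0[N N0 /= TN].
near (pinfty_nbhs R) => lam.
have lamL : 1 + L <= lam by near: lam; apply: nbhs_pinfty_ge; rewrite num_real.
have lam1 : 1 <= lam by near: lam; apply: nbhs_pinfty_ge.
have lamN : N / c < lam by near: lam; apply: nbhs_pinfty_gt; rewrite num_real.
have /(_ _ x Kx)/andP[//|Y1 _] := near Yd lam.
have : `|curve phi lam x| <= N.
  by apply: TN; exists (lam - L), x; split; rewrite ?subrK // lerBrDr.
apply/negP; rewrite -ltNge.
apply: lt_le_trans (normr_coord_le _ i); apply: lt_le_trans Y1.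
rewrite ltr_pdivrMr // mulrC in lamN.
by apply: (lt_le_trans lamN); rewrite ler_wpM2l ?ler_eXnr // ltW.
Unshelve. all: by end_near.
Qed.

Theorem theorem4p3p1 (R : realType) (n : nat) (p q : mpoly n.+1 R)
  (lead_notin : ~ principal_ideal (lex_lead_term q) (lex_lead_term p))
  (tentacle_cond : forall z : 'I_n.+1 -> int, Nn1 z ->
     exists (T : set 'rV[R]_n.+1) (pi : 'rV[R]_n.+1 -> 'rV[R]_n.+1),
     [/\ tentacles_in (nonneg_set q) T,
         of_degree T z,
         flips pi,
         ~ tentacles_in (nonneg_set p) (pi @` T)
       & forall T' : set 'rV[R]_n.+1,
           tentacles_in (nonneg_set q) T' -> ~ bounded_set T' ->
           pi @` T' `<=` pi @` T ->
           ~ tentacles_in (nonneg_set p) (pi @` T')]) :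
  ~ exists t : mpoly n.+1 R, nonneg_poly t /\
      forall y : 'rV[R]_n.+1, 0 <= peval p y - peval t y * peval q y.
Proof.
case=> t [t_ge0 pt].
(* [B] bounds the exponents of [p] and those of the monomials of [t q]. *)
pose B := (msize p + (msize q + msize t))%N.
pose z (i : 'I_n.+1) : int := (base_weight B i)%:Z.
have zN : Nn1 z.
  split=> i; first by rewrite /z lez_nat expn_gt0.
  by rewrite /z lez_nat leq_pexp2l // leq_sub2l.
have [T [_ [[_ Tq] [K0 [phi [[cK0 K0i phi0] TE degphi]]] [I _ <-] _ H]]] :=
  tentacle_cond z zN.
have [K [cK Ki KK0 [c [C [c0 Kc]]]]] := subcompact_off_hyperplanes cK0 K0i.
have K_n0 : K !=set0 by case: Ki => x /interior_subset; exists x.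
have Yz i := growth_curve c0 Kc (phi0 i) (degphi i).
have defs : \forall lam \near +oo, forall i, rf_defined (phi i) lam.
  by apply: filter_forall => i; exact: near_rf_defined.
have curveT lam x : 1 <= lam -> (forall i, rf_defined (phi i) lam) -> K x ->
    T (curve phi lam x).
  by move=> lam1 def /KK0 Kx; rewrite TE; exists lam, x.
have pM y : peval (t * q) y <= peval p y.
  by rewrite -subr_ge0 /peval mevalM; exact: pt.
have [dom|dom] := domination_dichotomy lead_notin
  (leq_addr _ _ : (msize p <= B)%N) (leq_addl _ _ : (msize q + msize t <= B)%N) (t := t).
  (* [p] dominates: contradiction on a reflected tail of [T]. *)
  have Fz i : growth K (fun lam x => flip I (curve phi lam x) 0 i) (base_weight B i).
    apply: growth_eq_norm (Yz i).
    by apply: nearW => lam x _; rewrite normr_flip.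
  have domF := dom _ K (fun lam x => flip I (curve phi lam x)) Fz.
  have [L L0 domL] : exists2 L : R, 0 < L & forall lam, L < lam ->
      (forall i, rf_defined (phi i) lam) /\ forall x, K x ->
      `|peval (t * q) (flip I (curve phi lam x))| < `|peval p (flip I (curve phi lam x))|.
    have [M [_ HM]] := filterI defs domF.
    exists (Num.max M 1) => [|lam]; first by rewrite lt_max ltr01 orbT.
    by rewrite gt_max => /andP[/HM].
  have shift_gt lam : 1 <= lam -> L < lam + L by move=> ?; lra.
  have defL lam : 1 <= lam -> forall i, rf_defined (phi i) (lam + L).
    by move=> /shift_gt /domL[].
  have tailT : tail K phi L `<=` T.
    move=> _ [lam [x [lam1 Kx ->]]]; apply: curveT (defL _ lam1) Kx.
    by lra.
  apply: (H (tail K phi L)).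
  - split; last exact: subset_trans Tq.
    have := rational_tentacle_flip_tail finset.set0 cK Ki phi0 defL.
    by rewrite flip0 image_id.
  - apply: unbounded_tail (Yz ord0) => //.
    by rewrite expn_gt0.
  - exact: image_subset.
  - split; first exact: rational_tentacle_flip_tail.
    move=> _ [_ [lam [x [lam1 Kx ->]]] <-]; rewrite /nonneg_set /= leNgt.
    apply/negP => p_lt0; have [_ /(_ x Kx)] := domL _ (shift_gt _ lam1).
    have tq_le0 := le_trans (pM _) (ltW p_lt0).
    by apply/negP; rewrite -leNgt !ler0_norm ?lerN2 ?pM // ltW.
(* [t q] dominates: contradiction at a single point of [T]. *)
have domY := dom _ K (curve phi) Yz.
have [x Kx] := K_n0.
have [lam lam1 [def /(_ x Kx)]] :=
  pinfty_ex_gt (num_real 1) (filterI defs domY).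
apply/negP; rewrite -leNgt.
have tq0 : 0 <= peval (t * q) (curve phi lam x).
  by rewrite /peval mevalM mulr_ge0 ?t_ge0 //; apply: Tq; apply: curveT => //; apply: ltW.
by rewrite !ger0_norm ?pM //; apply: le_trans (pM _).
Qed.
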